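(* Let $u\in\mathcal{X}$ be the unique solution of the variational problem: find $u\in\mathcal{X}$ such that $(B(u),v)_{\mathcal{V}}=(f,v)_{\mathcal{V}}$ for all $v\in\mathcal{V}$. Let $v_{\mathrm a}\in\mathcal{V}_{\mathrm a}$ be arbitrary and assume that $B(\mathcal{V}_{\mathrm a})\subseteq\mathcal{V}_{\mathrm t}$. Then $$\Vert \mathcal{R}(v_{\mathrm a})\Vert_{\mathcal{V}^*}=\Vert u-v_{\mathrm a}\Vert_B$$ and $$\Vert \mathcal{R}(v_{\mathrm a})\Vert_{\mathcal{V}_{\mathrm t}^*}\le \Vert u-v_{\mathrm a}\Vert_B\le \Vert \mathcal{R}(v_{\mathrm a})\Vert_{\mathcal{V}_{\mathrm t}^*}+\Vert P_{\mathcal{V}_{\mathrm t}^\perp}f\Vert_{\mathcal{V}}.$$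
   Context: Let $\rho$ be the standard Gaussian density on $\mathbb{R}$, let $\mathcal{V}:=L^2(\mathbb{R},\rho)$ be the weighted $L^2$-space with inner product $(\cdot,\cdot)_{\mathcal{V}}$, and let $\{p_j\}_{j\ge 0}$ be an orthonormal basis of $\mathcal{V}$ consisting of polynomials with $\deg p_j=j$. The exponent is $h(y)=\sum_{j=0}^{d_h-1}\boldsymbol{h}[j]\,p_j(y)$ with real coefficients $\boldsymbol{h}[j]$ and $d_h\in\mathbb{N}$. Set $y_0=0$ and $f(y)=\exp(h(y_0))\,h'(y)$. Let $\mathcal{X}=\{u\in H^2(\mathbb{R},\rho): u(y_0)=0\}$, where $H^2(\mathbb{R},\rho)$ is the $\rho$-weighted Sobolev space, and let $B(v)=v'-v\,h'$ (applied to elements of $\mathcal{X}$ and to polynomials). For $d_a,d_t\in\mathbb{N}_{>0}$, the ansatz space is $\mathcal{V}_{\mathrm a}=\operatorname{span}\{p_j: 1\le j\le d_a-1\}$ and the test space is $\mathcal{V}_{\mathrm t}=\operatorname{span}\{p_j:0\le j\le d_t-1\}$. The energy norm is $\Vert v\Vert_B:=\Vert B(v)\Vert_{\mathcal{V}}$. The residual is $\mathcal{R}(w):=(f-B(w),\,\cdot\,)_{\mathcal{V}}\in\mathcal{V}^*$; $\Vert\cdot\Vert_{\mathcal{V}^*}$ is the dual norm, and $\Vert R\Vert_{\mathcal{V}_{\mathrm t}^*}=\sup\{|R(v)|: v\in\mathcal{V}_{\mathrm t},\ \Vert v\Vert_{\mathcal{V}}=1\}$ is the norm of the restriction of $R\in\mathcal{V}^*$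 to $\mathcal{V}_{\mathrm t}$. $P_{\mathcal{V}_{\mathrm t}^\perp}$ denotes the orthogonal projection of $\mathcal{V}$ onto the orthogonal complement of $\mathcal{V}_{\mathrm t}$. *)

(* Defs.v *)
From HB Require Import structures.
From mathcomp Require Import all_boot all_order all_algebra.
From mathcomp Require Import all_classical all_reals all_analysis.

Set Implicit Arguments.
Unset Strict Implicit.
Unset Printing Implicit Defensive.

Import Order.TTheory GRing.Theory Num.Theory.
Import numFieldNormedType.Exports.

Local Open Scope classical_set_scope.
Local Open Scope ring_scope.

(* Elements of the function spaces below are represented by functions R -> R;
   among Borel functions every predicate and operation is invariant under
   equality a.e. for the Gaussian measure (equivalently, Lebesgue-a.e. equality,
   since the Gaussian density is positive everywhere). *)

Definition gauss (R : realType) : {measure set (measurableTypeR R) -> \bar R} :=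
  normal_prob (0 : R) 1.

Section WeightedL2.
Context {R : realType}.
Implicit Types (u v w : R -> R) (W : set (R -> R)).

Definition Vspace : set (R -> R) := [set v | v \in Lfun (gauss R) 2%:E].

Definition Vinner u v : R := \int[gauss R]_y (u y * v y).

Definition Vnorm v : \bar R := 'N[gauss R]_2%:E[EFin \o v].

Definition Vae_eq u v : Prop := {ae gauss R, forall y, u y = v y}.

Definition orth_compl W : set (R -> R) :=
  [set v | Vspace v /\ forall w, W w -> Vinner v w = 0].

(* Determined up to a.e. equality whenever it exists. *)
Definition orth_proj W v : R -> R :=
  xget (cst 0) [set w | W w /\ orth_compl W (v \- w)].

(* Norm of the restriction to W of a functional on Vspace; with W := Vspace
   this is the norm of the dual of Vspace. *)
Definition dual_norm W (F : (R -> R) -> R) : \bar R :=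
  ereal_sup [set `|F v|%:E | v in W `&` [set v | Vnorm v = 1%E]].

Definition poly_orthonormal_basis (p : nat -> {poly R}) : Prop :=
  [/\ forall j, size (p j) = j.+1,
      forall i j, Vinner (horner (p i)) (horner (p j)) = (i == j)%:R &
      forall v, Vspace v ->
        Vnorm (fun y => v y - (\sum_(j < n) Vinner v (horner (p j)) *: p j).[y])
          @[n --> \oo] --> 0%E].

Definition poly_span (p : nat -> {poly R}) (m n : nat) : set (R -> R) :=
  [set v | Vspace v /\ exists c : nat -> R,
     Vae_eq v (horner (\sum_(m <= j < n) c j *: p j))].

Definition ansatz_space (p : nat -> {poly R}) (da : nat) := poly_span p 1 da.

Definition test_space (p : nat -> {poly R}) (dt : nat) := poly_span p 0 dt.

End WeightedL2.

Section Sobolev.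
Context {R : realType}.
Implicit Types (u v g phi : R -> R).

Definition test_function phi : Prop :=
  (forall n x, derivable (derive1n n phi) x 1) /\
  compact (closure [set x | phi x != 0]).

Definition is_weak_derivative u g : Prop :=
  [/\ locally_integrable [set: R] u, locally_integrable [set: R] g &
      forall phi, test_function phi ->
        \int[lebesgue_measure]_x (u x * derive1 phi x) =
        - \int[lebesgue_measure]_x (g x * phi x)].

(* Determined up to a.e. equality whenever it exists. *)
Definition weak_derivative u : R -> R :=
  xget (cst 0) [set g | is_weak_derivative u g].

Definition H2space : set (R -> R) :=
  [set u | Vspace u /\ exists u1 u2,
     [/\ is_weak_derivative u u1, is_weak_derivative u1 u2,
         Vspace u1 & Vspace u2]].

Definition y0 : R := 0.

(* The value of u at y0 is that of its continuous representative. *)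
Definition Xspace : set (R -> R) :=
  [set u | H2space u /\ exists v, [/\ continuous v, Vae_eq u v & v y0 = 0]].

End Sobolev.

Section Problem.
Context {R : realType}.
Variable h : {poly R}.
Implicit Types (u v w : R -> R).

Definition rhs : R -> R := fun y => expR h.[y0] * (deriv h).[y].

Definition Bop v : R -> R := fun y => weak_derivative v y - v y * (deriv h).[y].

Definition energy_norm v : \bar R := Vnorm (Bop v).

Definition residual w : (R -> R) -> R := fun v => Vinner (rhs \- Bop w) v.

(* The clause Vspace (Bop u) makes the left-hand pairing an inner product of
   two elements of Vspace. *)
Definition solution u : Prop :=
  [/\ Xspace u, Vspace (Bop u) &
      forall v, Vspace v -> Vinner (Bop u) v = Vinner rhs v].

Definition unique_solution u : Prop :=
  solution u /\ forall w, solution w -> Vae_eq w u.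

End Problem.

(* Main.v *)
Require Import Defs.
From HB Require Import structures.
From mathcomp Require Import all_boot all_order all_algebra.
From mathcomp Require Import all_classical all_reals all_analysis.
From mathcomp Require Import measurable_realfun ring lra.

Import Order.TTheory GRing.Theory Num.Theory.
Import numFieldNormedType.Exports.

Local Open Scope classical_set_scope.
Local Open Scope ring_scope.

Set Implicit Arguments.
Unset Strict Implicit.
Unset Printing Implicit Defensive.

(** Write [f] for [rhs h].  Everything rests on the identity
    [Bop h (u \- va) = f \- Bop h va] almost everywhere; call this function
    [g].  The residual at [va] is by definition the functional [Vinner g], and
    the energy norm of the error is the norm of [g].

    The rest is Hilbert space geometry.  A functional that is represented on a
    linear space [W] by an element [w] of [W] has dual norm [Vnorm w] on [W]
    ([dual_norm_represented]).  On the whole space the representative is [g],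
    which is the first claim.  On the test space it is the orthogonal
    projection of [g]; because [Bop h va] lies in the test space, this is
    [s \- Bop h va], where [s], a partial Fourier sum of [f], is the projection
    of [f].  The remaining part of [g] is [f \- s], the projection of [f] onto
    the orthogonal complement ([orth_proj_compl]), and the upper bound is
    the triangle inequality for this orthogonal splitting.  The lower bound is
    monotonicity of a supremum.

    The identity for [g] has two ingredients.  First, [Bop h u = f] almost
    everywhere, by testing the variational equation against the difference of
    the two sides ([solution_Bop]).  Second, [Bop h] is additive modulo equality
    almost everywhere ([BopB]).  As [weak_derivative] is a choice among all weak
    derivatives, additivity amounts to the uniqueness of weak derivatives, that
    is, to the fundamental lemma of the calculus of variations
    ([fundamental_lemma]).  Its test functions are
    [exp (- c / ((x - a) * (b - x)))], cut off outside the open interval from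
    [a] to [b]: as [c] decreases to 0 they increase to the indicator of the
    interval, so a locally integrable function that annihilates them all has
    integral zero over every interval and vanishes at its Lebesgue points.  The element [va] has a weak derivative
    because it agrees almost everywhere with a polynomial, and the Gaussian and
    the Lebesgue measure have the same null sets. *)

#[local] Instance gauss_ae_filter (R : realType) :
  Filter (nbhs (almost_everywhere (gauss R))).
Proof. exact: (@ae_filter_ringOfSetsType _ (measurableTypeR R) R (gauss R)). Qed.

#[local] Instance lebesgue_ae_filter (R : realType) :
  Filter (nbhs (almost_everywhere (@lebesgue_measure R))).
Proof.
exact: (@ae_filter_ringOfSetsType _ (measurableTypeR R) R lebesgue_measure).
Qed.

(** * The Gaussian L2 space and dual norms *)

Section GaussL2.
Context {R : realType}.
Implicit Types (u v w f g : R -> R) (W : set (R -> R)).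

Lemma Vspace_measurable v : Vspace v ->
  measurable_fun [set: measurableTypeR R] v.
Proof. by rewrite /Vspace /= inE => /andP[/[!inE]]. Qed.

Lemma integrable_sqr_Vspace v : measurable_fun [set: measurableTypeR R] v ->
  (\int[gauss R]_y (v y * v y)%:E < +oo)%E -> Vspace v.
Proof.
move=> mv iv; rewrite /Vspace /= inE; apply/andP; split; rewrite inE//=.
rewrite /finite_norm unlock /Lnorm poweR_lty//.
rewrite (le_lt_trans _ iv)//.
under eq_integral => x _ do rewrite /= powR_mulrn// real_normK ?num_real// expr2.
by [].
Qed.

Lemma VspaceB u v : Vspace u -> Vspace v -> Vspace (u \- v).
Proof.
move=> Vu Vv; have p1 : (1 <= 2%:E :> \bar R)%E by rewrite lee_fin ler1n.
by rewrite /Vspace /= -/(u - v); apply: rpredB.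
Qed.

Lemma VspaceZ (c : R) v : Vspace v -> Vspace (fun y => c * v y).
Proof.
move=> Vv; have p1 : (1 <= 2%:E :> \bar R)%E by rewrite lee_fin ler1n.
by rewrite /Vspace /= -/(c *: v); apply: rpredZ.
Qed.

Lemma Vspace0 : Vspace (cst 0 : R -> R).
Proof. exact: Lfun_cst. Qed.

Lemma VspaceD u v : Vspace u -> Vspace v -> Vspace (u \+ v).
Proof.
move=> Vu Vv; have p1 : (1 <= 2%:E :> \bar R)%E by rewrite lee_fin ler1n.
by rewrite /Vspace /= -/(u + v); apply: rpredD.
Qed.

Lemma Vspace_integrableM u v : Vspace u -> Vspace v ->
  (gauss R).-integrable setT (EFin \o (fun y => u y * v y)).
Proof. by move=> Vu Vv; apply/Lfun1_integrable; exact: Lfun2_mul_Lfun1. Qed.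

Lemma VinnerC u v : Vinner u v = Vinner v u.
Proof. by rewrite /Vinner; under eq_Rintegral do rewrite mulrC. Qed.

Lemma VinnerBl u v w : Vspace u -> Vspace v -> Vspace w ->
  Vinner (u \- v) w = Vinner u w - Vinner v w.
Proof.
move=> Vu Vv Vw; rewrite /Vinner.
under eq_Rintegral do rewrite /= mulrBl.
by rewrite RintegralB//; exact: Vspace_integrableM.
Qed.

Lemma VinnerDl u v w : Vspace u -> Vspace v -> Vspace w ->
  Vinner (u \+ v) w = Vinner u w + Vinner v w.
Proof.
move=> Vu Vv Vw; rewrite /Vinner.
under eq_Rintegral do rewrite /= mulrDl.
by rewrite RintegralD//; exact: Vspace_integrableM.
Qed.

Lemma VinnerZl c u w : Vspace u -> Vspace w ->
  Vinner (fun y => c * u y) w = c * Vinner u w.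
Proof.
move=> Vu Vw; rewrite /Vinner.
under eq_Rintegral do rewrite -mulrA.
by rewrite RintegralZl//; exact: Vspace_integrableM.
Qed.

Lemma Vinner_ge0 u : 0 <= Vinner u u.
Proof. by apply: Rintegral_ge0 => y _; rewrite -expr2 sqr_ge0. Qed.

Lemma integral_sqrE u : Vspace u ->
  (\int[gauss R]_y (u y * u y)%:E)%E = (Vinner u u)%:E.
Proof.
move=> Vu; rewrite /Vinner /Rintegral fineK//.
by apply: integrable_fin_num => //; exact: Vspace_integrableM.
Qed.

Lemma VnormE u : Vspace u -> Vnorm u = (Num.sqrt (Vinner u u))%:E.
Proof.
move=> Vu; rewrite /Vnorm unlock /Lnorm.
under eq_integral => x _ do
  rewrite /= powR_mulrn// real_normK ?num_real// expr2.
by rewrite integral_sqrE// poweR_EFin powR12_sqrt// Vinner_ge0.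
Qed.

Lemma Vinner_eq0 u : Vspace u -> Vinner u u = 0 -> Vae_eq u (cst 0).
Proof.
move=> Vu u0.
have mu2 : measurable_fun [set: measurableTypeR R] (EFin \o (fun y => u y * u y)).
  by apply/measurable_EFinP; apply: measurable_funM; exact: Vspace_measurable.
have : (\int[gauss R]_y `|(u y * u y)%:E| = 0)%E.
  under eq_integral => y _ do rewrite gee0_abs ?lee_fin -?expr2 ?sqr_ge0// expr2.
  by rewrite integral_sqrE// u0.
move/(ae_eq_integral_abs (gauss R) measurableT mu2).
apply: filterS => y /(_ I) /= [] /eqP; rewrite mulf_eq0 orbb => /eqP ->.
by [].
Qed.

Lemma Vae_eq_refl u : Vae_eq u u.
Proof. by apply: aeW. Qed.

Lemma Vae_eq_trans u v w : Vae_eq u v -> Vae_eq v w -> Vae_eq u w.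
Proof. by apply: filterS2 => y -> ->. Qed.

Lemma Vae_eqB u u' v v' : Vae_eq u u' -> Vae_eq v v' ->
  Vae_eq (u \- v) (u' \- v').
Proof. by apply: filterS2 => y /= -> ->. Qed.

Lemma Vae_eqM u u' v v' : Vae_eq u u' -> Vae_eq v v' ->
  Vae_eq (fun y => u y * v y) (fun y => u' y * v' y).
Proof. by apply: filterS2 => y /= -> ->. Qed.

Lemma Vae_eq_integral u v : measurable_fun [set: measurableTypeR R] u ->
  measurable_fun [set: measurableTypeR R] v -> Vae_eq u v ->
  (\int[gauss R]_y (u y)%:E = \int[gauss R]_y (v y)%:E)%E.
Proof.
move=> mu mv uv; apply: ae_eq_integral => //; [exact/measurable_EFinP..|].
by move: uv; apply: filterS => y -> _.
Qed.

Lemma Vae_eq_Vspace u v : measurable_fun [set: measurableTypeR R] u ->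
  Vspace v -> Vae_eq u v -> Vspace u.
Proof.
move=> mu Vv uv; have mv := Vspace_measurable Vv.
apply: integrable_sqr_Vspace => //.
have -> : (\int[gauss R]_y (u y * u y)%:E = \int[gauss R]_y (v y * v y)%:E)%E.
  by apply: Vae_eq_integral (Vae_eqM uv uv); exact: measurable_funM.
by rewrite integral_sqrE// ltry.
Qed.

Lemma Vae_eq_Vinner u v w : Vspace u -> Vspace v -> Vspace w -> Vae_eq u v ->
  Vinner u w = Vinner v w.
Proof.
move=> Vu Vv Vw uv; rewrite /Vinner /Rintegral; congr fine.
by apply: Vae_eq_integral (Vae_eqM uv (Vae_eq_refl w));
  apply: measurable_funM; exact: Vspace_measurable.
Qed.

Lemma Vae_eq_Vnorm u v : Vspace u -> Vspace v -> Vae_eq u v ->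
  Vnorm u = Vnorm v.
Proof.
move=> Vu Vv uv; rewrite !VnormE// (Vae_eq_Vinner Vu Vv Vu uv).
by rewrite VinnerC (Vae_eq_Vinner Vu Vv Vv uv).
Qed.

Lemma Vinner_sub_sqr (c : R) u v : Vspace u -> Vspace v ->
  Vinner (u \- (fun y => c * v y)) (u \- (fun y => c * v y)) =
  Vinner u u - 2 * c * Vinner u v + c ^+ 2 * Vinner v v.
Proof.
move=> Vu Vv; have Vcv := VspaceZ c Vv; set d := u \- _.
have Vd : Vspace d by exact: VspaceB.
have dE w : Vspace w -> Vinner d w = Vinner u w - c * Vinner v w.
  by move=> Vw; rewrite VinnerBl// VinnerZl.
by rewrite dE// (VinnerC u d) (VinnerC v d) !dE// (VinnerC v u); ring.
Qed.

(** Bessel's inequality for one unit vector, which is the Cauchy-Schwarz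
    inequality in the only case that a dual norm requires. *)
Lemma Vinner_unit_le u v : Vspace u -> Vspace v -> Vinner v v = 1 ->
  `|Vinner u v| <= Num.sqrt (Vinner u u).
Proof.
move=> Vu Vv v1; rewrite -sqrtr_sqr ler_wsqrtr//.
have := Vinner_ge0 (u \- (fun y => Vinner u v * v y)).
by rewrite Vinner_sub_sqr// v1; lra.
Qed.

Lemma Vinner_Vnorm1 v : Vspace v -> Vnorm v = 1%E -> Vinner v v = 1.
Proof.
move=> Vv; rewrite VnormE// => -[] /(congr1 (fun x => x ^+ 2)).
by rewrite sqr_sqrtr ?Vinner_ge0// expr1n.
Qed.

(** The Riesz representation on [W]: Cauchy-Schwarz bounds the dual norm, and
    [w] divided by its norm attains the bound.  The unit vector [e] serves when
    [w] is null: a supremum over an empty set would be [-oo] instead of 0. *)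
Lemma dual_norm_represented W (F : (R -> R) -> R) w e :
  W `<=` Vspace -> (forall c v, W v -> W (fun y => c * v y)) ->
  W w -> W e -> Vnorm e = 1%E -> (forall v, W v -> F v = Vinner w v) ->
  dual_norm W F = Vnorm w.
Proof.
move=> WV WZ Ww We e1 FE; have Vw := WV _ Ww.
rewrite /dual_norm; apply/eqP; rewrite eq_le; apply/andP; split.
  apply: ge_ereal_sup => _ [v [Wv v1] <-]; rewrite FE// VnormE// lee_fin.
  by apply: Vinner_unit_le => //; [exact: WV|apply: Vinner_Vnorm1 => //; exact: WV].
have [w0|w0] := eqVneq (Vinner w w) 0.
  rewrite VnormE// w0 sqrtr0; apply: (@le_trans _ _ `|F e|%:E); first by rewrite lee_fin.
  by apply: ereal_sup_ubound; exists e.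
have wgt0 : 0 < Vinner w w by rewrite lt_def w0 Vinner_ge0.
have sgt0 : 0 < Num.sqrt (Vinner w w) by rewrite sqrtr_gt0.
set s := Num.sqrt (Vinner w w) in sgt0 *.
have ssE : Vinner w w = s ^+ 2 by rewrite sqr_sqrtr// ltW.
have Vsw := VspaceZ s^-1 Vw.
have innE : Vinner w (fun y => s^-1 * w y) = s.
  by rewrite VinnerC VinnerZl// ssE expr2 mulKf// gt_eqF.
apply: ereal_sup_ubound; exists (fun y => s^-1 * w y).
  split; first exact: WZ.
  by rewrite /= VnormE// VinnerZl// innE mulVf ?gt_eqF// sqrtr1.
by rewrite FE ?innE ?gtr0_norm ?VnormE//; exact: WZ.
Qed.

End GaussL2.

(** * Smooth bump functions *)

Section Bump.
Context {R : realType}.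
Implicit Types (c t x a b : R) (k : nat) (q r : {poly R}).

(** The powers [t ^- k] are there because the derivative of [flat_exp c k] is a
    combination of [flat_exp c k.+1] and [flat_exp c k.+2]. *)
Definition flat_exp c k t : R :=
  if 0 < t then t ^- k * expR (- (c / t)) else 0.

Lemma flat_exp_gt0E c k t : 0 < t ->
  flat_exp c k t = t ^- k * expR (- (c / t)).
Proof. by rewrite /flat_exp => ->. Qed.

Lemma flat_exp_le0 c k t : t <= 0 -> flat_exp c k t = 0.
Proof. by rewrite /flat_exp leNgt => /negPf ->. Qed.

Lemma flat_expS c k t : t * flat_exp c k.+1 t = flat_exp c k t.
Proof.
have [t0|t0] := ltP 0 t; last by rewrite !flat_exp_le0// mulr0.
by rewrite !flat_exp_gt0E// mulrA exprS invfM mulrA divff ?mul1r// gt_eqF.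
Qed.

(** The exponential series gives [exp (c / t) >= (c / t) ^+ k.+2 / (k.+2)`!], so
    [exp (- c / t)] absorbs the pole of order [k] with two powers of [t] to
    spare, which makes the derivative at 0 vanish. *)
Lemma flat_exp_bound c k t : 0 < c ->
  `|flat_exp c k t| <= (k.+2)`!%:R / c ^+ k.+2 * t ^+ 2.
Proof.
move=> c0; have [t0|t0] := ltP 0 t; last first.
  rewrite flat_exp_le0// normr0 mulr_ge0 ?sqr_ge0// divr_ge0// exprn_ge0//.
  exact: ltW.
rewrite flat_exp_gt0E// ger0_norm; last first.
  by rewrite mulr_ge0 ?expR_ge0// invr_ge0 exprn_ge0// ltW.
rewrite expRN -invfM.
have ct0 : 0 < c / t by rewrite divr_gt0.
have := expR_ge1Dxn k.+1 (ltW ct0).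
set e := expR _; set F := _`!%:R => eb.
have F0 : 0 < F :> R by rewrite ltr0n fact_gt0.
have {}eb : (c / t) ^+ k.+2 / F <= e by rewrite (le_trans _ eb)// lerDr.
have cF0 : 0 < (c / t) ^+ k.+2 / F by rewrite divr_gt0// exprn_gt0.
have e0 : 0 < e by exact: lt_le_trans eb.
have tk0 : 0 < t ^+ k by rewrite exprn_gt0.
have -> : F / c ^+ k.+2 * t ^+ 2 = (t ^+ k * ((c / t) ^+ k.+2 / F))^-1.
  rewrite exprMn exprVn -(addn2 k) (exprD t); field.
  by rewrite !gt_eqF// exprn_gt0.
have [h1 h2] := (mulr_gt0 tk0 cF0, mulr_gt0 tk0 e0).
by rewrite lef_pV2 ?posrE// ler_pM2l.
Qed.

Lemma is_derive_flat0 (f : R -> R) (C : R) :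
  (forall t, `|f t| <= C * t ^+ 2) -> is_derive (0 : R) (1 : R) f 0.
Proof.
move=> fC; have f0 : f 0 = 0.
  by apply/eqP; rewrite -normr_le0 (le_trans (fC 0))// expr0n mulr0.
have C0 : 0 <= C by have := fC 1; rewrite expr1n mulr1; apply: le_trans.
have gC z : `|f z / z| <= C * `|z|.
  have [->|z0] := eqVneq z 0; first by rewrite invr0 mulr0 !normr0 mulr0.
  rewrite normrM normfV ler_pdivrMr ?normr_gt0// (le_trans (fC z))//.
  by rewrite -mulrA -expr2 -normrX ger0_norm ?sqr_ge0.
apply/is_derive1_caratheodory; exists (fun z => f z / z); split.
- move=> z; rewrite f0 !subr0; have [->|z0] := eqVneq z 0.
    by rewrite f0 mulr0.
  by rewrite divfK.
- rewrite /prop_for /continuous_at invr0 mulr0; apply/cvgr0Pnorm_le => e e0.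
  near=> z; rewrite (le_trans (gC z))//.
  have : `|z| <= e / (C + 1).
    near: z; apply: cvgr0_norm_le; first exact: cvg_id.
    by rewrite divr_gt0// ltr_wpDl.
  rewrite ler_pdivlMr ?ltr_wpDl// => h; rewrite (le_trans _ h)// mulrC.
  by rewrite ler_wpM2l// lerDl.
- by rewrite invr0 mulr0.
Unshelve. all: by end_near. Qed.

Lemma is_derive_flat_exp c k t : 0 < c ->
  is_derive t (1 : R) (flat_exp c k)
    (c * flat_exp c k.+2 t - k%:R * flat_exp c k.+1 t).
Proof.
move=> c0; have [t0|t0|->] := ltgtP t 0; last 1 first.
- rewrite !flat_exp_le0// !mulr0 subr0.
  exact: is_derive_flat0 (fun s => flat_exp_bound k s c0).
- rewrite !flat_exp_le0 ?ltW// !mulr0 subr0.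
  apply: (@near_eq_is_derive _ _ _ (cst 0)).
  by near=> s; rewrite flat_exp_le0// ltW//; near: s; exact: lt_nbhsl.
- pose G (s : R) : R := s ^+ k * expR (- c * s).
  apply: (@near_eq_is_derive _ _ _ (G \o (fun s => s^-1))).
    near=> s; rewrite flat_exp_gt0E ?/G /= ?exprVn ?mulNr//.
    by near: s; exact: lt_nbhsr.
  have tn0 : t != 0 by rewrite gt_eqF.
  have dV : is_derive t (1 : R) (fun s : R => s^-1) (- t ^- 2 *: (1 : R)).
    by apply: (@is_deriveV _ id).
  have dG : is_derive t^-1 (1 : R) G
      (t^-1 ^+ k *: (expR (- c * t^-1) * (- c)) +
       expR (- c * t^-1) *: ((k%:R * t^-1 ^+ k.-1) *: (1 : R))).
    have -> : G = (id : R -> R) ^+ k * (expR \o (fun s => - c * s)).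
      by apply/funext => s; rewrite /G !fctE.
    have dexp : is_derive t^-1 (1 : R) (expR \o (fun s : R => - c * s))
        (expR (- c * t^-1) * - c).
      have dlin := @is_deriveZ _ R R id (- c) t^-1 1 1 (is_derive_id _ _).
      apply: is_derive1_comp; apply: (is_derive_eq dlin).
      by rewrite /GRing.scale /= mulr1.
    have dX := @is_deriveX _ R id k t^-1 1 1 (is_derive_id _ _).
    by apply: (is_derive_eq (is_deriveM dX dexp)); rewrite !fctE.
  apply: (is_derive_eq (@is_derive1_comp _ G (fun s => s^-1) t _ _ dG dV)).
  rewrite !flat_exp_gt0E// /GRing.scale /= mulNr !mulr1 -!exprVn.
  set e := expR _; set s := t^-1; case: k {G dG} => [|k] /=.
    by rewrite !mul0r; ring.
  by rewrite !exprS; ring.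
Unshelve. all: by end_near. Qed.

Definition poly_flat q r c k x : R := q.[x] * flat_exp c k r.[x].

(** The family [poly_flat] is stable under differentiation, since [flat_expS]
    brings all terms of the derivative to the common exponent [k.+2].  Hence all
    its members are smooth. *)
Lemma is_derive_poly_flat q r c k x : 0 < c ->
  is_derive x (1 : R) (poly_flat q r c k)
    (poly_flat (deriv q * r ^+ 2 + c *: (q * deriv r)
      - k%:R *: (q * deriv r * r)) r c k.+2 x).
Proof.
move=> c0.
have dE : is_derive x (1 : R) (flat_exp c k \o horner r)
    ((c * flat_exp c k.+2 r.[x] - k%:R * flat_exp c k.+1 r.[x]) * r^`().[x]).
  by apply: is_derive1_comp; exact: is_derive_flat_exp.
apply: (is_derive_eq (is_deriveM (is_derive_poly q x) dE)).
rewrite /poly_flat /GRing.scale /= -(flat_expS c k) -(flat_expS c k.+1).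
by rewrite !(hornerD, hornerN, hornerM, hornerZ, horner_exp); ring.
Qed.

Lemma poly_flat_derive1n q r c k n : 0 < c ->
  exists q' k', (poly_flat q r c k)^`(n)%classic = poly_flat q' r c k'.
Proof.
move=> c0; elim: n => [|n [q' [k' IH]]]; first by exists q, k.
do 2 eexists; rewrite derive1nS IH; apply/funext => x; rewrite derive1E.
exact: (@derive_val _ _ _ _ _ _ _ (is_derive_poly_flat q' r k' x c0)).
Qed.

(** The polynomial [(x - a) * (b - x)] is positive exactly on the open interval,
    so a single factor [flat_exp] cuts off at both ends. *)
Definition bump a b c : R -> R :=
  poly_flat 1 (('X - a%:P) * (b%:P - 'X)) c 0.

Lemma bump_gt0E a b c x : a < x < b ->
  bump a b c x = expR (- (c / ((x - a) * (b - x)))).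
Proof.
move=> /andP[ax xb]; rewrite /bump /poly_flat !hornerE.
by rewrite flat_exp_gt0E ?mulr_gt0 ?subr_gt0// expr0 invr1 mul1r.
Qed.

Lemma bump_out a b c x : a <= b -> ~~ (a < x < b) -> bump a b c x = 0.
Proof.
move=> ab xab; rewrite /bump /poly_flat flat_exp_le0 ?mulr0// !hornerE.
by move: xab; rewrite negb_and -!leNgt => /orP[xa|bx]; nra.
Qed.

Lemma bump_le1 a b c x : 0 < c -> a <= b -> 0 <= bump a b c x <= 1.
Proof.
move=> c0 ab; have [xab|xab] := boolP (a < x < b); last first.
  by rewrite bump_out// lexx ler01.
rewrite bump_gt0E// expR_ge0 -expR0 ler_expR oppr_le0 divr_ge0 ?ltW//.
by move: xab => /andP[ax xb]; rewrite mulr_gt0 ?subr_gt0.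
Qed.

Lemma test_function_bump a b c : 0 < c -> a <= b -> test_function (bump a b c).
Proof.
move=> c0 ab; split=> [n x|].
  have [q' [k' ->]] := poly_flat_derive1n 1 (('X - a%:P) * (b%:P - 'X)) 0 n c0.
  exact: (@ex_derive _ _ _ _ _ _ _ (is_derive_poly_flat q' _ k' x c0)).
apply: (@subclosed_compact _ _ `[a, b]%classic).
- exact: closed_closure.
- exact: segment_compact.
- have /closure_id -> : closed `[a, b]%classic by exact: interval_closed.
  apply: closureS => x /=; apply: contra_neqP => /negP xab.
  apply: bump_out => //; apply: contraNN xab => /andP[ax xb].
  by rewrite in_itv /= !ltW.
Qed.

Lemma cvg_bump a b x : a < x < b ->
  bump a b n.+1%:R^-1 x @[n --> \oo] --> (1 : R).
Proof.
move=> xab; under eq_fun do rewrite bump_gt0E//.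
have c0 : n.+1%:R^-1 / ((x - a) * (b - x)) @[n --> \oo] --> (0 : R).
  rewrite -[0](mul0r ((x - a) * (b - x))^-1).
  by apply: cvgM; [exact: cvg_harmonic|exact: cvg_cst].
have {}c0 : - (n.+1%:R^-1 / ((x - a) * (b - x))) @[n --> \oo] --> (0 : R).
  by rewrite -[0]oppr0; exact: cvgN.
have e1 : expR (0 : R) = 1 by exact: expR0.
by rewrite -[X in nbhs X]e1; exact: (continuous_cvg _ (@continuous_expR R _) c0).
Qed.

End Bump.

(** * The fundamental lemma of the calculus of variations *)

Section Fundamental.
Context {R : realType}.
Implicit Types (f g u phi psi : R -> R) (a b M x : R).
Local Notation mu := (@lebesgue_measure R).

Lemma derivable_continuous f : (forall x, derivable f x 1) -> continuous f.
Proof.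
by move=> df x; apply: differentiable_continuous; exact/derivable1_diffP.
Qed.

Lemma test_function_bounded_support phi : test_function phi ->
  exists2 M, 0 < M &
    forall x, ~~ (- M <= x <= M) -> phi x = 0 /\ derive1 phi x = 0.
Proof.
move=> [_ /compact_bounded [M [_ hM]]].
exists (`|M| + 1); first by rewrite ltr_wpDl.
have phi0 x : `|M| + 1 < `|x| -> phi x = 0.
  move=> Mx; apply/eqP; apply/negP => /negP px.
  have : `|x| <= `|M| + 1.
    apply: (hM (`|M| + 1)) => //; last exact: subset_closure.
    by rewrite (le_lt_trans (ler_norm _))// ltrDl.
  by rewrite leNgt Mx.
move=> x; rewrite -ler_norml -ltNge => Mx; split; first exact: phi0.
rewrite derive1E; rewrite -(@near_eq_derive _ _ _ (cst 0)) ?derive_cst//.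
near=> z; rewrite phi0//; near: z.
exact: (cvgr_gt (`|x|)) (cvg_norm cvg_id) _ Mx.
Unshelve. all: by end_near. Qed.

Lemma locally_integrable_itvcc g a b : locally_integrable setT g ->
  mu.-integrable `[a, b] (EFin \o g).
Proof.
move=> [mg _ ig]; apply/integrableP; split.
  by apply/measurable_EFinP; exact: measurable_funTS.
by apply: ig => //; exact: segment_compact.
Qed.

Lemma locally_integrable_itvoo g a b : locally_integrable setT g ->
  mu.-integrable `]a, b[ (EFin \o g).
Proof.
move=> lg; apply: integrableS (locally_integrable_itvcc a b lg) => //.
exact: subset_itv_oo_cc.
Qed.

Lemma integrable_loc_mul_compact g psi M : locally_integrable setT g ->
  continuous psi -> (forall x, ~~ (- M <= x <= M) -> psi x = 0) ->
  mu.-integrable setT (EFin \o (fun x => g x * psi x)).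
Proof.
move=> lg cpsi psi0.
have -> : EFin \o (fun x => g x * psi x) =
    ((EFin \o g) \* (EFin \o psi))%E \_ `[- M, M].
  apply/funext => x; rewrite patchE; case: ifPn => // /negP xM.
  rewrite /= psi0 ?mulr0//; apply/negP => h; apply: xM.
  by rewrite inE /= in_itv.
apply/(integrable_mkcond _ _).1 => //; apply: integrableMl => //.
- exact: locally_integrable_itvcc.
- by apply: measurable_funTS; exact: continuous_measurable_fun.
- have /compact_bounded : compact (psi @` `[- M, M]%classic).
    apply: continuous_compact; last exact: segment_compact.
    exact: continuous_subspaceT.
  move=> [B [Br hB]]; exists B; split => // B' BB' x xM.
  by apply: (hB _ BB'); exists x.
Qed.

Lemma test_function_continuous phi : test_function phi ->
  continuous phi /\ continuous (derive1 phi).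
Proof.
move=> [dphi _]; split; apply: derivable_continuous => x.
  exact: (dphi 0%N).
by have := dphi 1%N x; rewrite derive1n1.
Qed.

Lemma integrable_loc_mul_test g phi : locally_integrable setT g ->
  test_function phi -> mu.-integrable setT (EFin \o (fun x => g x * phi x)).
Proof.
move=> lg tphi; have [M _ phi0] := test_function_bounded_support tphi.
apply: (integrable_loc_mul_compact (M := M)) => //.
  by have [] := test_function_continuous tphi.
by move=> x /phi0[].
Qed.

Lemma integrable_loc_mul_derive_test g phi : locally_integrable setT g ->
  test_function phi ->
  mu.-integrable setT (EFin \o (fun x => g x * derive1 phi x)).
Proof.
move=> lg tphi; have [M _ phi0] := test_function_bounded_support tphi.
apply: (integrable_loc_mul_compact (M := M)) => //.
  by have [] := test_function_continuous tphi.
by move=> x /phi0[].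
Qed.

(** Dominated convergence along the bumps with [c = 1 / (n + 1)], which are
    bounded by 1 and converge to 1 inside the interval. *)
Lemma integral_itv_eq0 g a b : locally_integrable setT g ->
  (forall phi, test_function phi -> \int[mu]_x (g x * phi x) = 0) ->
  a < b -> (\int[mu]_(x in `]a, b[) (g x)%:E = 0)%E.
Proof.
move=> lg g0 ab.
pose phi n := bump a b n.+1%:R^-1.
have tphi n : test_function (phi n).
  by apply: test_function_bump; rewrite ?invr_gt0 ?ltW.
have ig := locally_integrable_itvoo a b lg.
have igphi n := integrable_loc_mul_test lg (tphi n).
have int0 n : (\int[mu]_(x in `]a, b[) (g x * phi n x)%:E = 0)%E.
  have <- : (\int[mu]_x (g x * phi n x)%:E = 0)%E.
    rewrite -[LHS]fineK; last by apply: integrable_fin_num => //; exact: igphi.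
    by congr EFin; exact: g0.
  rewrite integral_mkcond; apply: eq_integral => x _; rewrite patchE.
  case: ifPn => // /negP xab; rewrite /phi bump_out ?mulr0 ?ltW//.
  by apply/negP => h; apply: xab; rewrite inE /= in_itv.
have [] := @dominated_convergence _ _ _ mu `]a, b[%classic
  (measurable_itv _) (fun n x => (g x * phi n x)%:E) (fun x => (g x)%:E)
  (fun x => `|g x|%:E).
- by move=> n; apply: measurable_funTS; exact: measurable_int (igphi n).
- exact: measurable_int ig.
- apply: aeW => x /=; rewrite in_itv /= => xab.
  apply: cvg_EFin; first by apply: nearW.
  suff : g x * phi n x @[n --> \oo] --> g x * 1 by rewrite mulr1.
  by apply: cvgM; [exact: cvg_cst|exact: cvg_bump].
- exact: integrable_abse ig.
- apply: aeW => x /= n _; rewrite lee_fin normrM ler_piMr//.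
  have /andP[p0 p1] : 0 <= phi n x <= 1.
    by apply: bump_le1; rewrite ?invr_gt0 ?ltW.
  by rewrite ger0_norm.
move=> _ _; under eq_fun do rewrite int0.
by move=> h; apply/esym/(cvg_unique _ (cvg_cst 0%E) h).
Qed.

(** The mean of [`|g y - g x|] over a ball is at least the absolute value of the
    mean of [g y - g x], which is [`|g x|] when [g] has mean zero there. *)
Lemma lebesgue_pt_eq0 g x : locally_integrable setT g ->
  (forall a b, a < b -> (\int[mu]_(y in `]a, b[) (g y)%:E = 0)%E) ->
  lebesgue_pt g x -> g x = 0.
Proof.
move=> lg g0 gx; apply/eqP; rewrite -normr_le0 -lee_fin.
apply: (cvge_ge _ gx); near=> r.
have r0 : 0 < r by near: r; exact: nbhs_right_gt.
have r2 : 0 < r *+ 2 by rewrite mulrn_wgt0.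
rewrite /davg /iavg (lebesgue_measure_ball _ (ltW r0)) inver gt_eqF//.
have ib : mu.-integrable (ball x r) (EFin \o g).
  by rewrite ball_itv; exact: locally_integrable_itvoo.
have icst : mu.-integrable (ball x r) (EFin \o cst (g x)).
  have icc : mu.-integrable `[x - r, x + r] (EFin \o cst (g x)).
    apply: continuous_compact_integrable; first exact: segment_compact.
    by apply: continuous_subspaceT => z; exact: cvg_cst.
  rewrite ball_itv; apply: integrableS icc => //; exact: subset_itv_oo_cc.
have mb : measurable (ball x r : set (measurableTypeR R)) by exact: measurable_ball.
have idiff : mu.-integrable (ball x r) (EFin \o (center (g x) \o g)).
  by have := integrableB mb ib icst.
have intE : (\int[mu]_(y in ball x r) (EFin \o (center (g x) \o g)) y =
    (- (g x * (r *+ 2)))%:E)%E.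
  rewrite /= (@integralB_EFin _ _ _ mu _ g (cst (g x)) mb ib icst).
  rewrite [X in (X - _)%E](_ : _ = 0%E); last first.
    by rewrite ball_itv; apply: g0; rewrite ltrBlDr -addrA ltrDl addr_gt0.
  have := integral_cst mu mb (g x)%:E; rewrite /= => ->.
  by rewrite lebesgue_measure_ball ?ltW// add0e -EFinM EFinN.
rewrite lee_pdivlMl// -EFinM.
have -> : (r *+ 2 * `|g x|)%:E = `|(- (g x * (r *+ 2)))%:E|%E.
  by rewrite /= normrN normrM (gtr0_norm r2) mulrC.
rewrite -intE; apply: le_abse_integral => //.
by case/integrableP: idiff.
Unshelve. all: by end_near. Qed.

(** The fundamental lemma of the calculus of variations; almost every point is
    a Lebesgue point. *)
Lemma fundamental_lemma g : locally_integrable setT g ->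
  (forall phi, test_function phi -> \int[mu]_x (g x * phi x) = 0) ->
  {ae mu, forall x, g x = 0}.
Proof.
move=> lg g0; have := lebesgue_differentiation lg; apply: filterS => x.
by apply: lebesgue_pt_eq0 => // a b; exact: integral_itv_eq0.
Qed.

End Fundamental.

(** * Weak derivatives *)

Section WeakDerivative.
Context {R : realType}.
Implicit Types (u v g k phi : R -> R) (h q : {poly R}).
Local Notation mu := (@lebesgue_measure R).

Lemma lebesgue_ae_Vae_eq u v : {ae mu, forall x, u x = v x} -> Vae_eq u v.
Proof.
move=> [A [mA A0 uvA]]; exists A; split=> //.
exact: (null_content_dominatesP _ _).1 (@normal_prob_dominates R 0 1) _ mA A0.
Qed.

Lemma gauss_pdf_gt0 (x : R) : 0 < normal_pdf 0 1 x.
Proof.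
by rewrite normal_pdfE ?oner_neq0// mulr_gt0 ?expR_gt0 ?normal_peak_gt0.
Qed.

(** A positive density with integral zero over a set leaves no room for a set of
    positive Lebesgue measure. *)
Lemma Vae_eq_lebesgue_ae u v : Vae_eq u v -> {ae mu, forall x, u x = v x}.
Proof.
move=> [A [mA A0 uvA]].
have mpdf : measurable_fun A (EFin \o (normal_pdf (0 : R) 1)).
  by apply/measurable_EFinP/measurable_funTS; exact: measurable_normal_pdf.
have : (\int[mu]_(x in A) `|(EFin \o (normal_pdf (0 : R) 1)) x| = 0)%E.
  rewrite -[RHS]A0; apply: eq_integral => x _.
  by rewrite /= ger0_norm// ltW// gauss_pdf_gt0.
move/(ae_eq_integral_abs mu mA mpdf); apply: filterS => x Ax.
apply/eqP/negPn/negP => /eqP uvx; have [] := Ax (uvA _ uvx).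
by apply/eqP; rewrite gt_eqF// gauss_pdf_gt0.
Qed.

Lemma weak_derivative_unique u g k :
  is_weak_derivative u g -> is_weak_derivative u k -> Vae_eq g k.
Proof.
move=> [_ lg ug] [_ lk uk]; apply: lebesgue_ae_Vae_eq.
have : {ae mu, forall x, (g \- k) x = 0}.
  apply: fundamental_lemma; first exact: locally_integrableB.
  move=> phi tphi; under eq_Rintegral do rewrite /= mulrBl.
  rewrite RintegralB//; [|exact: integrable_loc_mul_test..].
  by apply/eqP; rewrite subr_eq0 -eqr_opp -ug// uk.
by apply: filterS => x /= /eqP; rewrite subr_eq0 => /eqP.
Qed.

Lemma is_weak_derivativeB u v g k :
  is_weak_derivative u g -> is_weak_derivative v k ->
  is_weak_derivative (u \- v) (g \- k).
Proof.
move=> [lu lg ug] [lv lk vk]; split; [exact: locally_integrableB..|].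
move=> phi tphi.
under eq_Rintegral do rewrite /= mulrBl.
under [in RHS]eq_Rintegral do rewrite /= mulrBl.
rewrite !RintegralB//; do ?[exact: integrable_loc_mul_test
  |exact: integrable_loc_mul_derive_test].
by rewrite ug// vk//; ring.
Qed.

Lemma continuous_locally_integrable g : continuous g ->
  locally_integrable setT g.
Proof.
move=> cg; split; [exact: continuous_measurable_fun|exact: openT|].
move=> K _ cK.
by have /integrableP[] := continuous_compact_integrable cK (continuous_subspaceT cg).
Qed.

(** Integration by parts; there are no boundary terms on an interval that is
    larger than the support of the test function. *)
Lemma is_weak_derivative_poly q : is_weak_derivative (horner q) (horner q^`()).
Proof.
have cq (q' : {poly R}) : continuous (horner q') by exact: continuous_horner.
split; [exact: continuous_locally_integrable..|].
move=> phi tphi; have [cphi cdphi] := test_function_continuous tphi.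
have [M M0 phi0] := test_function_bounded_support tphi.
have MM : - (M + 1) < M + 1 by rewrite gtrN// addr_gt0.
have dphi x : derivable phi x 1 by exact: tphi.1 0%N x.
have E (F : R -> R) : (forall x, ~~ (- M <= x <= M) -> F x = 0) ->
    \int[mu]_x F x = \int[mu]_(x in `[- (M + 1), M + 1]) F x.
  move=> F0; rewrite [RHS]Rintegral_mkcond; apply: eq_Rintegral => x _.
  rewrite patchE; case: ifPn => // /negP xM; apply: F0; apply/negP => /andP[h1 h2].
  by apply: xM; rewrite inE /= in_itv /=; apply/andP; split; lra.
rewrite (E (fun x => q.[x] * derive1 phi x)); last first.
  by move=> x /phi0[_ ->]; rewrite mulr0.
rewrite (E (fun x => q^`().[x] * phi x)); last first.
  by move=> x /phi0[-> _]; rewrite mulr0.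
have [p1 _] : phi (M + 1) = 0 /\ derive1 phi (M + 1) = 0.
  by apply: phi0; apply/negP => /andP[]; lra.
have [p2 _] : phi (- (M + 1)) = 0 /\ derive1 phi (- (M + 1)) = 0.
  by apply: phi0; apply/negP => /andP[]; lra.
rewrite (@Rintegration_by_parts _ (horner q) phi (horner q^`()) (derive1 phi))//.
- by rewrite p1 p2 !mulr0 subrr sub0r.
- exact: continuous_subspaceT.
- split; [by move=> x _; exact: derivable_horner| |].
    by apply: cvg_at_right_filter; exact: cq.
  by apply: cvg_at_left_filter; exact: cq.
- by move=> x _; rewrite -derivE.
- exact: continuous_subspaceT.
- split; [by move=> x _| |].
    by apply: cvg_at_right_filter; exact: cphi.
  by apply: cvg_at_left_filter; exact: cphi.
Qed.

Lemma Vae_eq_is_weak_derivative u v g :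
  measurable_fun [set: measurableTypeR R] u -> Vae_eq u v ->
  is_weak_derivative v g -> is_weak_derivative u g.
Proof.
move=> mu_ uv [lv lg vg]; have [mv _ iv] := lv.
have luv := Vae_eq_lebesgue_ae uv.
have lu : locally_integrable setT u.
  split => //; first exact: openT.
  move=> K _ cK; have mK := compact_measurable cK.
  rewrite (@ae_eq_integral _ _ _ mu K (fun x => `|v x|%:E))//.
  - exact: iv.
  - by apply/measurable_EFinP; apply: measurable_funTS; exact: measurableT_comp.
  - by apply/measurable_EFinP; apply: measurable_funTS; exact: measurableT_comp.
  - by move: luv; apply: filterS => x -> _.
split=> // phi tphi; rewrite -vg//; congr fine; apply: ae_eq_integral => //.
- exact: measurable_int (integrable_loc_mul_derive_test lu tphi).
- exact: measurable_int (integrable_loc_mul_derive_test lv tphi).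
- by move: luv; apply: filterS => x -> _.
Qed.

Lemma weak_derivativeP u g : is_weak_derivative u g ->
  is_weak_derivative u (weak_derivative u).
Proof. by move=> ug; apply: (@xgetPex _ _ [set k | is_weak_derivative u k]); exists g. Qed.

Lemma Bop_measurable h u g : is_weak_derivative u g ->
  measurable_fun [set: measurableTypeR R] (Bop h u).
Proof.
move=> /weak_derivativeP[[mu_ _ _] [mg _ _] _].
apply: measurable_funB => //; apply: measurable_funM => //.
by apply: continuous_measurable_fun; exact: continuous_horner.
Qed.

(** The two sides are built from independent choices of weak derivatives, which
    uniqueness identifies almost everywhere. *)
Lemma BopB h u v g k : is_weak_derivative u g -> is_weak_derivative v k ->
  Vae_eq (Bop h (u \- v)) (Bop h u \- Bop h v).
Proof.
move=> /weak_derivativeP ug /weak_derivativeP vk.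
have uvgk := is_weak_derivativeB ug vk.
have := weak_derivative_unique (weak_derivativeP uvgk) uvgk.
by apply: filterS => x dx; rewrite /Bop /= dx /=; ring.
Qed.

End WeakDerivative.

(** * Polynomial orthonormal bases *)

Section PolynomialBasis.
Context {R : realType}.
Variable p : nat -> {poly R}.
Hypothesis hp : poly_orthonormal_basis p.
Implicit Types (q : {poly R}) (f g v w : R -> R) (c : nat -> R).

(** A unit inner product [(p_j, p_j) = 1] already says that [p_j] is square
    integrable, because [fine +oo = 0]. *)
Lemma Vspace_basis j : Vspace (horner (p j)).
Proof.
case: hp => _ ortho _; apply: integrable_sqr_Vspace.
  by apply: continuous_measurable_fun; exact: continuous_horner.
have := ortho j j; rewrite /Vinner /Rintegral eqxx.
case: (integral _ _ _) => [r _|/eqP|/eqP] /=; first exact: ltry.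
  by rewrite eq_sym oner_eq0.
by rewrite eq_sym oner_eq0.
Qed.

Lemma horner_scaleE a q : horner (a *: q) = fun y => a * horner q y.
Proof. by apply/funext => y; rewrite hornerZ. Qed.

Lemma horner_addE q1 q2 : horner (q1 + q2) = horner q1 \+ horner q2.
Proof. by apply/funext => y; rewrite hornerD. Qed.

Lemma horner0E : horner (0 : {poly R}) = cst 0.
Proof. by apply/funext => y; rewrite horner0. Qed.

(** The sizes of the [p j] allow to cancel leading coefficients, so every
    polynomial is a combination of the [p j] and inherits their square
    integrability. *)
Lemma Vspace_poly q : Vspace (horner q).
Proof.
have [hsize _ _] := hp.
elim: (size q) {-2}q (leqnn (size q)) => {q} [|n IH] q.
  by rewrite leqn0 size_poly_eq0 => /eqP ->; rewrite horner0E; exact: Vspace0.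
move=> qn; set r := q - (q`_n / (p n)`_n) *: p n.
have pn0 : (p n)`_n != 0.
  have := lead_coef_eq0 (p n); rewrite lead_coefE hsize /= => ->.
  by rewrite -size_poly_eq0 hsize.
have rn : (size r <= n)%N.
  apply/leq_sizeP => j; rewrite leq_eqVlt => /predU1P[<-|nj].
    by rewrite /r coefB coefZ divfK// subrr.
  have pj : (size (p n) <= j)%N by rewrite hsize.
  rewrite /r coefB coefZ (nth_default 0 pj) mulr0 subr0.
  by rewrite nth_default// (leq_trans qn).
have -> : q = r + (q`_n / (p n)`_n) *: p n by rewrite /r subrK.
rewrite horner_addE horner_scaleE.
by apply: VspaceD; [exact: IH|apply: VspaceZ; exact: Vspace_basis].
Qed.

Lemma poly_spanZ m n a v : poly_span p m n v ->
  poly_span p m n (fun y => a * v y).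
Proof.
move=> [Vv [c vE]]; split; first exact: VspaceZ.
exists (fun j => a * c j); move: vE; apply: filterS => y ->.
by rewrite -hornerZ scaler_sumr; under [in RHS]eq_bigr do rewrite -scalerA.
Qed.

Lemma poly_spanB m n v w : poly_span p m n v -> poly_span p m n w ->
  poly_span p m n (v \- w).
Proof.
move=> [Vv [c vE]] [Vw [c' wE]]; split; first exact: VspaceB.
exists (fun j => c j - c' j); move: vE wE; apply: filterS2 => y /= -> ->.
rewrite -hornerN -hornerD -sumrB.
by under [in RHS]eq_bigr do rewrite scalerBl.
Qed.

Lemma poly_span_sum m n c :
  poly_span p m n (horner (\sum_(m <= j < n) c j *: p j)).
Proof.
by split; [exact: Vspace_poly|exists c; exact: Vae_eq_refl].
Qed.

Lemma poly_span_basis n j : (j < n)%N -> poly_span p 0 n (horner (p j)).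
Proof.
move=> jn; split; first exact: Vspace_basis.
exists (fun i => (i == j)%:R).
have -> : \sum_(0 <= i < n) (i == j)%:R *: p i = p j.
  rewrite (bigD1_seq j)/= ?mem_index_iota ?iota_uniq// eqxx scale1r big1 ?addr0//.
  by move=> i /negPf ->; rewrite scale0r.
exact: Vae_eq_refl.
Qed.

Lemma Vinner_sumr g (s : seq nat) c : Vspace g ->
  Vinner g (horner (\sum_(j <- s) c j *: p j)) =
  \sum_(j <- s) c j * Vinner g (horner (p j)).
Proof.
move=> Vg; elim: s => [|i s IH].
  rewrite !big_nil horner0E VinnerC /Vinner.
  by under eq_Rintegral do rewrite /= mul0r; rewrite Rintegral_cst// mul0r.
rewrite !big_cons horner_addE horner_scaleE VinnerC.
rewrite VinnerDl//; [|by apply: VspaceZ; exact: Vspace_basis|exact: Vspace_poly].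
by rewrite VinnerZl ?(VinnerC _ g) ?IH//; exact: Vspace_basis.
Qed.

Definition fourier_sum n f : R -> R :=
  horner (\sum_(0 <= j < n) Vinner f (horner (p j)) *: p j).

Lemma fourier_sum_orth n f w : Vspace f -> poly_span p 0 n w ->
  Vinner (f \- fourier_sum n f) w = 0.
Proof.
have [_ ortho _] := hp.
move=> Vf [Vw [c wE]]; set d := f \- _.
have Vd : Vspace d by apply: VspaceB => //; exact: Vspace_poly.
rewrite VinnerC (Vae_eq_Vinner Vw (Vspace_poly _) Vd wE) VinnerC Vinner_sumr//.
apply: big1_seq => i /= /[!mem_index_iota] /= iN.
rewrite VinnerBl//; [|exact: Vspace_poly|exact: Vspace_basis].
rewrite (VinnerC (fourier_sum n f)) Vinner_sumr; last exact: Vspace_basis.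
rewrite (bigD1_seq i)/= ?mem_index_iota ?iota_uniq// ortho eqxx mulr1.
rewrite big1 ?addr0 ?subrr ?mulr0// => j ji.
by rewrite ortho eq_sym (negPf ji) mulr0.
Qed.

End PolynomialBasis.

(** * Orthogonal projections and the error identity *)

Section Projection.
Context {R : realType}.
Implicit Types (u v w f : R -> R) (W : set (R -> R)) (h : {poly R}).

Lemma orth_complB W v w : orth_compl W v -> orth_compl W w ->
  W `<=` Vspace -> orth_compl W (v \- w).
Proof.
move=> [Vv v0] [Vw w0] WV; split=> [|z Wz]; first exact: VspaceB.
by rewrite VinnerBl ?v0 ?w0 ?subrr//; exact: WV.
Qed.

(** A projection is unique up to equality almost everywhere: the difference of
    two of them lies both in [W] and in its orthogonal complement.  This
    identifies the element that [orth_proj] chooses. *)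
Lemma orth_projP W f w : W `<=` Vspace ->
  (forall v v', W v -> W v' -> W (v \- v')) ->
  W w -> orth_compl W (f \- w) -> Vspace (orth_proj W f) /\
  Vae_eq (orth_proj W f) w.
Proof.
move=> WV WB Ww fw.
have [Wo fo] : W (orth_proj W f) /\ orth_compl W (f \- orth_proj W f).
  by apply: (@xgetPex _ _ [set w | W w /\ orth_compl W (f \- w)]); exists w.
split; first exact: WV.
have zE : (f \- w) \- (f \- orth_proj W f) = orth_proj W f \- w.
  by apply/funext => y /=; ring.
have Wz := WB _ _ Wo Ww; have Vz := WV _ Wz.
have z0 : Vinner (orth_proj W f \- w) (orth_proj W f \- w) = 0.
  rewrite -{1}zE VinnerBl//; [|by case: fw|by case: fo].
  by rewrite fw.2// fo.2// subrr.
have := Vinner_eq0 Vz z0; apply: filterS => y /= /eqP.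
by rewrite subr_eq0 => /eqP.
Qed.

(** If [s] is the projection of [f] onto [W], then [f \- s] is the projection
    onto the complement: the difference of the two is [s], which is
    orthogonal to everything that is orthogonal to [W]. *)
Lemma orth_proj_compl W f s : W `<=` Vspace -> W s -> Vspace f ->
  orth_compl W (f \- s) ->
  Vnorm (orth_proj (orth_compl W) f) = Vnorm (f \- s).
Proof.
move=> WV Ws Vf fs.
have Vs := WV _ Ws.
have ss : f \- (f \- s) = s by apply/funext => y /=; ring.
have [Vo oE] : Vspace (orth_proj (orth_compl W) f) /\
    Vae_eq (orth_proj (orth_compl W) f) (f \- s).
  apply: orth_projP => //.
  - by move=> v [].
  - by move=> v v' Wv Wv'; exact: orth_complB.
  - by rewrite ss; split=> // w [_ w0]; rewrite VinnerC w0.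
by apply: Vae_eq_Vnorm => //; exact: VspaceB.
Qed.

(** The equation is tested with [Bop h u \- rhs h]. *)
Lemma solution_Bop h u : Vspace (rhs h) -> solution h u ->
  Vae_eq (Bop h u) (rhs h).
Proof.
move=> Vf [_ VBu uE].
have Vd : Vspace (Bop h u \- rhs h) by exact: VspaceB.
have d0 : Vinner (Bop h u \- rhs h) (Bop h u \- rhs h) = 0.
  by rewrite VinnerBl// uE// subrr.
have := Vinner_eq0 Vd d0; apply: filterS => y /= /eqP.
by rewrite subr_eq0 => /eqP.
Qed.

Lemma Vnorm_orthD_le v w : Vspace v -> Vspace w -> Vinner v w = 0 ->
  (Vnorm (v \+ w)%R <= Vnorm v + Vnorm w)%E.
Proof.
move=> Vv Vw vw0; have Vvw := VspaceD Vv Vw.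
rewrite !VnormE// -EFinD lee_fin VinnerDl// !(VinnerC _ (v \+ w)) !VinnerDl//.
rewrite (VinnerC w v) vw0 addr0 add0r.
have [a0 b0] := (Vinner_ge0 v, Vinner_ge0 w).
rewrite -[leRHS]ger0_norm ?addr_ge0 ?sqrtr_ge0// -sqrtr_sqr ler_wsqrtr//.
rewrite sqrrD !sqr_sqrtr// addrAC lerDl.
by rewrite mulrn_wge0// mulr_ge0// sqrtr_ge0.
Qed.

End Projection.

Theorem theorem2p4 (R : realType) (p : nat -> {poly R})
    (hp : poly_orthonormal_basis p)
    (dh : nat) (hcoef : 'I_dh -> R) (h : {poly R})
    (hE : h = \sum_(j < dh) hcoef j *: p j)
    (da dt : nat) (da_gt0 : (0 < da)%N) (dt_gt0 : (0 < dt)%N)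
    (u : R -> R) (hu : unique_solution h u)
    (va : R -> R) (hva : ansatz_space p da va)
    (hB : Bop h @` ansatz_space p da `<=` test_space p dt) :
  dual_norm Vspace (residual h va) = energy_norm h (u \- va)%R /\
  (dual_norm (test_space p dt) (residual h va) <= energy_norm h (u \- va)%R)%E /\
  (energy_norm h (u \- va)%R <=
     dual_norm (test_space p dt) (residual h va) +
     Vnorm (orth_proj (orth_compl (test_space p dt)) (rhs h)))%E.
Proof.
have [solu _] := hu; have [[[_ [u1 [_ [du _ _ _]]]] _] _ _] := solu.
have [Vva [c vaE]] := hva.
have dva := Vae_eq_is_weak_derivative (Vspace_measurable Vva) vaE
  (is_weak_derivative_poly _).
have Vf : Vspace (rhs h).
  have -> : rhs h = horner (expR h.[y0] *: h^`()) by rewrite horner_scaleE.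
  exact: Vspace_poly hp _.
have TBva : test_space p dt (Bop h va) by apply: hB; exists va.
have VBva : Vspace (Bop h va) by case: TBva.
set g := rhs h \- Bop h va.
have Vg : Vspace g by exact: VspaceB.
have BuvaE : Vae_eq (Bop h (u \- va)) g.
  apply: Vae_eq_trans (BopB h du dva) _.
  by apply: Vae_eqB; [exact: solution_Bop|exact: Vae_eq_refl].
have energyE : energy_norm h (u \- va) = Vnorm g.
  apply: Vae_eq_Vnorm => //; apply: Vae_eq_Vspace BuvaE => //.
  exact: Bop_measurable (is_weak_derivativeB du dva).
have Tp0 : test_space p dt (horner (p 0%N)) by exact: poly_span_basis.
have p0_1 : Vnorm (horner (p 0%N)) = 1%E.
  have [_ ortho _] := hp.
  by rewrite VnormE ?ortho ?eqxx ?sqrtr1//; case: Tp0.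
have TV : test_space p dt `<=` Vspace by move=> v [].
have dualV : dual_norm Vspace (residual h va) = Vnorm g.
  by apply: (dual_norm_represented (e := horner (p 0%N))) => //;
    [move=> a v; exact: VspaceZ|exact: TV].
pose s := fourier_sum p dt (rhs h).
have Ts : test_space p dt s by exact: poly_span_sum.
have Vs := TV _ Ts.
have Vn : Vspace (rhs h \- s) by exact: VspaceB.
pose t := s \- Bop h va.
have Tt : test_space p dt t by exact: poly_spanB.
have Vt := TV _ Tt.
have gE : g = t \+ (rhs h \- s) by apply/funext => y; rewrite /g /t /=; ring.
(* [g] and [t] differ by [rhs h \- s], which is orthogonal to the test space. *)
have dualT : dual_norm (test_space p dt) (residual h va) = Vnorm t.
  apply: (dual_norm_represented (e := horner (p 0%N))) => //.
  - by move=> a v; exact: poly_spanZ.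
  - move=> v Tv; rewrite /residual -/g gE VinnerDl//; last exact: TV.
    by rewrite fourier_sum_orth// addr0.
split; [by rewrite dualV energyE|split].
  rewrite energyE -dualV; apply: le_ereal_sup; apply: image_subset.
  by move=> v [Tv v1]; split=> //; exact: TV.
rewrite energyE dualT (orth_proj_compl (s := s))//; last first.
  by split=> // w Tw; exact: fourier_sum_orth.
by rewrite gE; apply: Vnorm_orthD_le => //; rewrite VinnerC fourier_sum_orth.
Qed.
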